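(* Let $r\ge1$. For $j\ge 1$, $k\ge 1$ and $n\ge 0$, the number of overpartitions $\pi$ of $n$ such that $maes(\pi;r)=k$ and exactly $j$ parts of $\pi$ have size greater than $k$ equals the number of overpartitions $\lambda$ of $n$ such that the smallest positive $(r+1)$-repeating size of $\lambda$ is $j$ and exactly $k+1$ parts of $\lambda$ have size greater than or equal to $j$.
   Context: An overpartition of $n$ is a partition of $n$ in which the last occurrence of each distinct part value may be overlined. A part equal to $t$ or $\overline t$ has size $t$. For an overpartition $\pi$, $maes(\pi;r)$ is the largest positive integer $t$ less than the size of the largest part of $\pi$ such that $t\ge r$ and $\pi$ has no parts of size $t,t-1,\ldots,t-r+1$; if no such $t$ exists, $maes(\pi;r)=0$. A positive integer $j$ is an $(r+1)$-repeating size of $\lambda$ if $\lambda$ has at least $r+1$ parts of size $j$. *)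

(* Defs.v *)
From HB Require Import structures.
From mathcomp Require Import all_boot.

Set Implicit Arguments.
Unset Strict Implicit.
Unset Printing Implicit Defensive.

(* A part is a pair (size, overlined?).  An overpartition is its list of parts
   in weakly decreasing order of size. *)
Definition part : Type := (nat * bool)%type.

Definition sizes (p : seq part) : seq nat := [seq x.1 | x <- p].

(* [x] may be directly followed by [y]: sizes weakly decrease, and a part that
   is overlined must be the last one of its size. *)
Definition part_rel : rel part :=
  fun x y => (y.1 <= x.1) && (x.2 ==> (y.1 < x.1)).

Definition is_overpartition (n : nat) (p : seq part) : bool :=
  [&& sorted part_rel p, 0 \notin sizes p & sumn (sizes p) == n].

Record overpartition (n : nat) : Type := Overpartition {
  parts :> seq part;
  partsP : is_overpartition n parts }.

HB.instance Definition _ n := [isSub for @parts n].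
HB.instance Definition _ n := [Choice of overpartition n by <:].
HB.instance Definition _ n := [Countable of overpartition n by <:].

(* Overpartitions of [n] have at most [n] parts, of size at most [n], so they
   embed in a finite type. *)
Section Finiteness.
Variable n : nat.

Definition op_code (p : overpartition n) : n.-bseq ('I_n.+1 * bool)%type :=
  insub_bseq n [seq (inord x.1, x.2) | x <- parts p].

Definition op_decode (c : n.-bseq ('I_n.+1 * bool)%type) :
    option (overpartition n) :=
  insub [seq (nat_of_ord x.1, x.2) | x <- c].

Lemma mem_leq_sumn (s : seq nat) x : x \in s -> x <= sumn s.
Proof.
elim: s => //= y s IHs; rewrite inE => /orP[/eqP ->|/IHs xs].
  exact: leq_addr.
exact: leq_trans xs (leq_addl _ _).
Qed.

Lemma size_leq_sumn (s : seq nat) : 0 \notin s -> size s <= sumn s.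
Proof.
elim: s => //= y s IHs; rewrite inE negb_or eq_sym -lt0n => /andP[y0 /IHs].
by rewrite -add1n; apply: leq_add.
Qed.

Lemma op_codeK : pcancel op_code op_decode.
Proof.
move=> p; rewrite /op_decode /op_code.
have /and3P[_ p0 /eqP pn] := partsP p.
have szp : size (parts p) <= n.
  by rewrite -[size _](size_map fst) -[leqRHS]pn size_leq_sumn.
rewrite /insub_bseq insubdK ?unfold_in /= ?size_map // -map_comp.
have -> : [seq ((fun x => (nat_of_ord x.1, x.2)) \o
    (fun x => (inord x.1 : 'I_n.+1, x.2))) x | x <- parts p] = parts p.
  apply: map_id_in => -[a b] /= abp; rewrite inordK // ltnS -[leqRHS]pn.
  by apply: mem_leq_sumn; apply/mapP; exists (a, b).
exact: valK.
Qed.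

End Finiteness.

HB.instance Definition _ n := isFinite.Build (overpartition n)
  (pcan_enumP (@op_codeK n)).

Definition largest_size (p : seq part) : nat := \max_(x <- sizes p) x.

(* The maximum over an empty range is 0, as required when no [t] exists. *)
Definition maes (p : seq part) (r : nat) : nat :=
  \max_(t < largest_size p | [&& 0 < t, r <= t &
      [forall i : 'I_r, t - i \notin sizes p]]) t.

Definition num_parts_gt (k : nat) (p : seq part) : nat :=
  count (fun x => k < x) (sizes p).

Definition num_parts_ge (j : nat) (p : seq part) : nat :=
  count (fun x => j <= x) (sizes p).

Definition repeating_size (m : nat) (p : seq part) (j : nat) : bool :=
  (0 < j) && (m <= count_mem j (sizes p)).

Definition smallest_repeating_size (m : nat) (p : seq part) (j : nat) : bool :=
  repeating_size m p j && [forall i : 'I_j, ~~ repeating_size m p i].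

(* Main.v *)
(* Conjugation of Ferrers diagrams acts on overpartitions: the last occurrence
   of a size is a corner of the diagram, overlining marks a corner, and
   transposition permutes corners.  If the sizes of [p] are
   [s_1 >= s_2 >= ...], padded with zeros, then its conjugate has exactly [s_j]
   parts of size at least [j], hence [s_j - s_(j+1)] parts of size [j].  On the
   other hand [maes p r = k >= 1] with [j] parts above [k] says that [s_j = k+1],
   that [s_j - s_(j+1) >= r+1], and that no earlier gap [s_i - s_(i+1)] exceeds
   [r].  Thus conjugation exchanges the two families. *)
Require Import Defs.
From mathcomp Require Import all_boot zify.

Set Implicit Arguments.
Unset Strict Implicit.
Unset Printing Implicit Defensive.

(** * Rows and columns of a Ferrers diagram *)

Lemma nth_sorted_geq (s : seq nat) (i j : nat) :
  sorted geq s -> i <= j -> nth 0 s j <= nth 0 s i.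
Proof.
move=> ss ij; have [js|sj] := ltnP j (size s); last by rewrite nth_default.
apply: (sorted_leq_nth _ _ 0 ss i j) => //.
- by move=> y x z /= yx zy; apply: leq_trans zy yx.
- exact: leqnn.
- exact: leq_ltn_trans ij js.
Qed.

(** Both sides say that the cell in row [i] (from 0) and column [t] (from 1) lies in the Ferrers
    diagram. As [t] is positive, the default 0 of [nth] stands for an empty row. *)
Lemma ltn_count_leq (s : seq nat) (t i : nat) :
  sorted geq s -> 0 < t -> (i < count (leq t) s) = (t <= nth 0 s i).
Proof.
move=> + t0; elim: s i => [|x s IHs] i ss.
  by rewrite nth_nil [RHS]leqNgt t0.
have {}IHs := IHs _ (path_sorted ss).
have [tx|xt] := leqP t x; first by case: i => [|i] /=; rewrite tx // add1n ltnS.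
have le_x l : nth 0 (x :: s) l <= x := nth_sorted_geq ss (leq0n l).
rewrite (_ : count _ _ = 0); first by have := le_x i; lia.
apply/eqP; rewrite /= leqNgt xt add0n -leqn0 leqNgt IHs -ltnNge.
exact: leq_ltn_trans (le_x 1) xt.
Qed.

Lemma count_leqE (s : seq nat) (t c : nat) : sorted geq s -> 0 < t ->
  0 < c -> (count (leq t) s == c) = (nth 0 s c < t <= nth 0 s c.-1).
Proof.
move=> ss t0 c0; have := ltn_count_leq c ss t0.
by have := ltn_count_leq c.-1 ss t0; lia.
Qed.

Lemma count_leqS (s : seq nat) (i : nat) :
  count (leq i) s = count (leq i.+1) s + count_mem i s.
Proof. by elim: s => //= x s ->; lia. Qed.

Lemma count_geq_iota (x m : nat) : x <= m -> count (geq x) (iota 1 m) = x.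
Proof.
move=> xm; rewrite -(subnKC xm) iotaD count_cat.
rewrite (eq_in_count (a2 := predT)); last by move=> i /=; rewrite mem_iota; lia.
rewrite [X in _ + X](eq_in_count (a2 := pred0)); last first.
  by move=> i /=; rewrite mem_iota; lia.
by rewrite count_predT size_iota count_pred0 addn0.
Qed.

(** Double counting: the cells of the diagram are summed by columns and by rows. *)
Lemma sumn_count_leq (s : seq nat) (m : nat) : {in s, forall x, x <= m} ->
  sumn [seq count (leq i) s | i <- iota 1 m] = sumn s.
Proof.
elim: s => [|x s IHs] sm; first by rewrite sumnE big_map big1.
rewrite /= -IHs; last by move=> y ys; rewrite sm // inE ys orbT.
rewrite -[X in _ = X + _](count_geq_iota (sm x (mem_head _ _))).
by rewrite !sumnE !big_map -sum1_count [X in _ = X + _]big_mkcond -big_split.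
Qed.

(** * Conjugation of overpartitions *)

Section Conjugate.
Implicit Types (p : seq part) (n : nat).

Lemma sorted_sizes p : sorted part_rel p -> sorted geq (sizes p).
Proof.
rewrite sorted_map; apply: sub_sorted => x y /=.
by case/andP.
Qed.

Lemma nth_sizes p i : nth 0 (sizes p) i = (nth (0, false) p i).1.
Proof.
have [ip|pi] := ltnP i (size p); first exact: nth_map.
by rewrite !nth_default // size_map.
Qed.

(** An overlined part of size [i] marks the corner at the foot of column [i], and that column
    becomes the row carrying the overline. *)
Definition conjugate p : seq part :=
  [seq (num_parts_ge i p, (i, true) \in p) | i <- iota 1 (head 0 (sizes p))].

Lemma sizes_conjugate p : sizes (conjugate p) =
  [seq count (leq i) (sizes p) | i <- iota 1 (head 0 (sizes p))].
Proof. by rewrite /sizes -map_comp. Qed.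

Lemma num_parts_ge_conjugate p m : sorted geq (sizes p) ->
  0 < m -> num_parts_ge m (conjugate p) = nth 0 (sizes p) m.-1.
Proof.
move=> ss m0; rewrite /num_parts_ge sizes_conjugate count_map.
rewrite -[RHS](@count_geq_iota _ (head 0 (sizes p))); last first.
  by rewrite -nth0 nth_sorted_geq.
apply: eq_in_count => i; rewrite mem_iota => /andP[i0 _] /=.
by rewrite -ltn_count_leq // prednK.
Qed.

Lemma count_mem_conjugate p m : sorted geq (sizes p) -> 0 < m ->
  count_mem m (sizes (conjugate p)) =
  nth 0 (sizes p) m.-1 - nth 0 (sizes p) m.
Proof.
move=> ss m0; have := count_leqS (sizes (conjugate p)) m.
have := num_parts_ge_conjugate ss m0.
have := num_parts_ge_conjugate ss (ltn0Sn m).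
by rewrite /num_parts_ge /= => -> -> ->; rewrite addKn.
Qed.

Lemma conjugate_is_overpartition n p :
  is_overpartition n p -> is_overpartition n (conjugate p).
Proof.
case/and3P=> /sorted_sizes ss p0 /eqP pn; apply/and3P; split.
- rewrite sorted_map; apply: (@sub_sorted _ (fun i j => j == i.+1)); last first.
    apply/(sortedP 0) => i; rewrite size_iota => iL.
    by rewrite !nth_iota ?addnS // ltnW.
  (* Columns [i] and [i.+1] differ in length by the multiplicity of [i], which is positive when [i]
     is overlined in [p]. *)
  move=> i _ /eqP -> /=; rewrite /part_rel /= /num_parts_ge.
  rewrite (count_leqS _ i) leq_addr /=; apply/implyP => ip.
  rewrite -addn1 leq_add2l -has_count has_pred1.
  by apply/mapP; exists (i, true).
- rewrite sizes_conjugate; apply/mapP => -[i]; rewrite mem_iota => /andP[i0 iL].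
  by have := ltn_count_leq 0 ss i0; rewrite nth0; lia.
- rewrite sizes_conjugate sumn_count_leq ?pn // => x /(nthP 0)[i _ <-].
  by rewrite -nth0 nth_sorted_geq.
Qed.

(* An overlined part is the last one of its size. *)
Lemma count_leq_overlined p i :
  sorted part_rel p -> 0 \notin sizes p -> i < size p ->
  (nth (0, false) p i).2 ->
  count (leq (nth 0 (sizes p) i)) (sizes p) = i.+1.
Proof.
move=> sp p0 ip oi; have ss := sorted_sizes sp.
have si0 : 0 < nth 0 (sizes p) i.
  by rewrite lt0n; apply: contraNneq p0 => <-; rewrite mem_nth // size_map.
apply/eqP; rewrite count_leqE //= leqnn andbT.
have [lt_ip|] := ltnP i.+1 (size p); last first.
  by move=> ?; rewrite [X in X < _]nth_default // size_map.
have /(sortedP (0, false))/(_ i lt_ip)/andP[_] := sp.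
by rewrite oi !nth_sizes.
Qed.

Lemma conjugateK n p : is_overpartition n p -> conjugate (conjugate p) = p.
Proof.
move=> op; have /and3P[sp p0 _] := op; have ss := sorted_sizes sp.
have /and3P[/sorted_sizes ss' _ _] := conjugate_is_overpartition op.
have head_conj : head 0 (sizes (conjugate p)) = size p.
  have -> : head 0 (sizes (conjugate p)) = count (leq 1) (sizes p).
    by rewrite sizes_conjugate; case: (sizes p) p0 => [|[|x] s].
  rewrite -[size p](size_map fst); apply/eqP; rewrite -all_count.
  by apply/allP => y yp; rewrite lt0n; apply: contraNneq p0 => <-.
have sz : size (conjugate (conjugate p)) = size p.
  by rewrite size_map size_iota.
apply: (@eq_from_nth _ (0, false)) => // i; rewrite sz => ip.
rewrite (nth_map 0) ?size_iota ?head_conj // nth_iota // add1n.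
rewrite num_parts_ge_conjugate //= nth_sizes [RHS]surjective_pairing.
(* An overlined part at index [a] ends its size, so [a.+1] parts are at least as large. Hence row
   [i.+1] of the conjugate is overlined exactly when the part at index [i] is. *)
congr (_, _); apply/mapP/idP => [[m _ [ci /esym mp]]|oi].
  have {mp}/(nthP (0, false))[a ap pa] : (m, true) \in p by rewrite mp.
  have := count_leq_overlined sp p0 ap; rewrite nth_sizes pa /=.
  by move: ci; rewrite /num_parts_ge => <- /(_ isT)[->]; rewrite pa.
have ci := count_leq_overlined sp p0 ip oi.
have pi : (nth 0 (sizes p) i, true) \in p.
  by rewrite nth_sizes -oi -surjective_pairing mem_nth.
exists (nth 0 (sizes p) i); last by rewrite /num_parts_ge ci pi.
rewrite mem_iota add1n ltnS -nth0 nth_sorted_geq // andbT lt0n.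
by apply: contraNneq p0 => <-; rewrite mem_nth // size_map.
Qed.

Definition op_conjugate n (p : overpartition n) : overpartition n :=
  Overpartition (conjugate_is_overpartition (partsP p)).

Lemma op_conjugateK n : involutive (@op_conjugate n).
Proof. by move=> p; apply: val_inj; apply: conjugateK (partsP p). Qed.

End Conjugate.

(** * Gaps between consecutive sizes and [maes] *)

Lemma largest_sizeE (p : seq part) :
  sorted geq (sizes p) -> largest_size p = nth 0 (sizes p) 0.
Proof.
move=> ss; apply/eqP; rewrite eqn_leq /largest_size; apply/andP; split.
  by apply/bigmax_leqP_seq => x /(nthP 0)[i _ <-] _; rewrite nth_sorted_geq.
case: (sizes p) => //= x s; exact: (@leq_bigmax_seq _ _ _ _ x) (mem_head _ _) _.
Qed.

(* The admissible [t] in the definition of [maes], tested only on the first size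
   below the gap: [count (leq t.+1) s] is the index of the largest size <= t. *)
Definition gap (s : seq nat) (r t : nat) : bool :=
  (t < nth 0 s 0) && (nth 0 s (count (leq t.+1) s) + r <= t).

Lemma gapE (s : seq nat) (r t : nat) : sorted geq s -> 0 < r ->
  gap s r t = [&& t < nth 0 s 0, r <= t & [forall i : 'I_r, t - i \notin s]].
Proof.
move=> ss r0; rewrite /gap; congr (_ && _).
set c := count _ _.
have Hc i : (i < c) = (t < nth 0 s i) by apply: ltn_count_leq.
apply/idP/andP => [le_ct|[rt /forallP gp]].
  split; first by lia.
  apply/forallP => i; apply/negP => /(nthP 0)[m _ sm].
  have ir := ltn_ord i; have := Hc m; rewrite sm.
  have [lt_mc|/(nth_sorted_geq ss)] := ltnP m c; first by lia.
  by rewrite sm; lia.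
(* If every size exceeds [t], the default 0 reduces the goal to [r <= t]. Otherwise a size in the
   window would be hit by the offset [t - nth 0 s c]. *)
have [cs|sc] := ltnP c (size s); last by rewrite nth_default.
have := Hc c; rewrite ltnn => /esym/negbT; rewrite -leqNgt => sct.
rewrite leqNgt; apply/negP => lt_t.
have ir : t - nth 0 s c < r by lia.
by have := gp (Ordinal ir); rewrite /= subKn // mem_nth.
Qed.

Lemma maes_eq (p : seq part) (r k : nat) :
  sorted geq (sizes p) -> 0 < r -> 0 < k ->
  maes p r = k <->
  gap (sizes p) r k /\ forall t, gap (sizes p) r t -> t <= k.
Proof.
move=> ss r0 k0.
pose P t := [&& 0 < t, r <= t & [forall i : 'I_r, t - i \notin sizes p]].
have -> : maes p r = \max_(t < nth 0 (sizes p) 0 | P t) t.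
  by rewrite -largest_sizeE.
have PE t : gap (sizes p) r t = (t < nth 0 (sizes p) 0) && P t.
  by rewrite gapE // /P; case: t => [|t] //=; case: (r) r0; rewrite //= ?andbF.
have Pmax t : gap (sizes p) r t ->
    t <= \max_(t < nth 0 (sizes p) 0 | P t) t.
  rewrite PE => /andP[tL Pt].
  exact: (@leq_bigmax_cond _ (fun t : 'I__ => P t) _ (Ordinal tL)).
split=> [maxk|[gk kmax]].
  split; last by rewrite -maxk.
  (* An empty range would give the maximum 0, against [0 < k]; so the maximum is attained. *)
  have [i Pi] : exists i : 'I_(nth 0 (sizes p) 0), P i.
    apply/existsP; apply: contraTT k0 => /existsPn noP.
    by rewrite -maxk big_pred0 // => i; apply: negbTE.
  have : 0 < #|[pred t : 'I_(nth 0 (sizes p) 0) | P t]|.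
    by apply/card_gt0P; exists i.
  move=> /(eq_bigmax_cond (@nat_of_ord _))[m Pm maxm].
  by rewrite PE -maxk maxm ltn_ord.
apply/eqP; rewrite eqn_leq Pmax // andbT.
by apply/bigmax_leqP => t Pt; apply: kmax; rewrite PE ltn_ord.
Qed.

(** The largest admissible [t] sits at the top of the first gap exceeding [r], one below the size
    that bounds this gap from above. *)
Lemma maes_num_parts_gt_iff (p : seq part) (r j k : nat) :
  sorted geq (sizes p) -> 0 < r -> 0 < j -> 0 < k ->
  let s := sizes p in
  maes p r = k /\ num_parts_gt k p = j <->
  [/\ nth 0 s j.-1 = k.+1, nth 0 s j + r.+1 <= nth 0 s j.-1 &
      forall i, 0 < i < j -> nth 0 s i.-1 <= nth 0 s i + r].
Proof.
move=> ss r0 j0 k0 s; rewrite maes_eq // /num_parts_gt -/s.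
have mono i i' : i <= i' -> nth 0 s i' <= nth 0 s i by apply: nth_sorted_geq.
have cntE t c : 0 < c ->
    (count (leq t.+1) s == c) = (nth 0 s c <= t < nth 0 s c.-1).
  by move=> c0; rewrite count_leqE.
have gapI c t : 0 < c -> nth 0 s c + r <= t -> t < nth 0 s c.-1 -> gap s r t.
  move=> c0 le_t lt_t; rewrite /gap (leq_trans lt_t) ?mono //=.
  by have /eqP -> : count (leq t.+1) s == c by rewrite cntE //; lia.
split=> [[[gk kmax] ckj]|[sj sj1 gaps]].
  have := gk; rewrite /gap [count _ _]ckj => /andP[_ gkj].
  have := cntE k j j0; rewrite [count _ _]ckj eqxx => /esym/andP[_ ksj].
  have sjk : nth 0 s j.-1 = k.+1.
    apply/eqP; rewrite eqn_leq ksj andbT leqNgt; apply/negP => lt_k.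
    by have := kmax k.+1 (gapI j _ j0 _ lt_k); rewrite ltnn; lia.
  split=> //; first by lia.
  move=> i /andP[i0 ij]; rewrite leqNgt; apply/negP => lt_s.
  (* An earlier gap exceeding [r] would have an admissible top larger than [k]. *)
  have := kmax (nth 0 s i.-1).-1 (gapI i _ i0 _ _).
  have := mono i j.-1; lia.
have ckj : count (leq k.+1) s = j by apply/eqP; rewrite cntE //; lia.
split=> //; split; first by apply: (gapI j) => //; lia.
move=> t /andP[t0 gt]; rewrite leqNgt; apply/negP => kt.
have := ltn_count_leq 0 ss (ltn0Sn t); rewrite t0.
(* Here [c.+1] sizes exceed [t]. If [c.+1 < j], then [t] witnesses an early gap exceeding [r];
   otherwise [t] lies below the size [k.+1]. *)
move: gt; case c_t : count => [//|c] gt _.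
have := cntE t c.+1 isT; rewrite c_t eqxx => /esym/andP[_ /= lt_t].
have [cj|jc] := ltnP c.+1 j; first by have := gaps c.+1 cj; rewrite /=; lia.
by have := mono j.-1 c; lia.
Qed.

(** Multiplicities in the conjugate are gaps of [p], so the first gap exceeding [r] becomes the
    smallest repeating size. The conditions reached are those obtained for [maes]. *)
Lemma smallest_repeating_conjugate_iff (p : seq part) (r j k : nat) :
  sorted geq (sizes p) -> 0 < j ->
  let s := sizes p in
  smallest_repeating_size r.+1 (conjugate p) j /\
    num_parts_ge j (conjugate p) = k.+1 <->
  [/\ nth 0 s j.-1 = k.+1, nth 0 s j + r.+1 <= nth 0 s j.-1 &
      forall i, 0 < i < j -> nth 0 s i.-1 <= nth 0 s i + r].
Proof.
move=> ss j0 s; rewrite num_parts_ge_conjugate // -/s.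
have repE i : 0 < i ->
    repeating_size r.+1 (conjugate p) i = (nth 0 s i + r.+1 <= nth 0 s i.-1).
  by move=> i0; rewrite /repeating_size count_mem_conjugate // i0 -/s; lia.
rewrite /smallest_repeating_size repE //.
split=> [[/andP[sj1 /forallP nrep] sj]|[sj sj1 gaps]].
  split=> // i /andP[i0 ij].
  by have := nrep (Ordinal ij); rewrite repE //=; lia.
split=> //; rewrite sj1 /=; apply/forallP => i.
have [i0|i0] := posnP i; first by rewrite /repeating_size i0.
by rewrite repE //; have := gaps i; rewrite i0 ltn_ord => /(_ isT); lia.
Qed.

Theorem theorem2p2 (r j k n : nat) (r_ge1 : 1 <= r) (j_ge1 : 1 <= j)
    (k_ge1 : 1 <= k) :
  #|[set p : overpartition n | (maes p r == k) && (num_parts_gt k p == j)]| =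
  #|[set l : overpartition n | smallest_repeating_size r.+1 l j
                               && (num_parts_ge j l == k.+1)]|.
Proof.
rewrite -(card_imset _ (inv_inj (@op_conjugateK n))); apply: eq_card => l.
(* Every [l] is the conjugate of its own conjugate [p], so membership is compared for [p] on one
   side and for its conjugate on the other. *)
rewrite -[l]op_conjugateK mem_imset; last exact: inv_inj (@op_conjugateK n).
move: (op_conjugate l) => {l} p; rewrite !inE.
have ss : sorted geq (sizes p) by have /and3P[/sorted_sizes] := partsP p.
have maesP := maes_num_parts_gt_iff ss r_ge1 j_ge1 k_ge1.
have repP := smallest_repeating_conjugate_iff r k ss j_ge1.
apply/andP/andP => [[/eqP mk /eqP cj]|[rj /eqP ck]].
  have [|rj ->] := repP.2 _; last by rewrite eqxx.
  exact: maesP.1 (conj mk cj).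
have [|-> ->] := maesP.2 _; last by rewrite !eqxx.
exact: repP.1 (conj rj ck).
Qed.
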